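(* Let $\delta > 0$ be a real number. There is an $n(\delta)$ such that for all $n \geq n(\delta)$, $$\binom{n}{2} - n^{5/3+\delta} \leq \mathrm{sat}(n,C_4,K_4) \leq \binom{n-2}{2}.$$
   Context: All graphs are finite and simple. A graph $G$ is $F$-free if it contains no (not necessarily induced) subgraph isomorphic to $F$. $G$ is $F$-saturated if $G$ is $F$-free but adding any nonedge to $G$ creates at least one copy of $F$. A copy of $H$ in $G$ is a (not necessarily induced) subgraph of $G$ isomorphic to $H$. $\mathrm{sat}(n,H,F)$ denotes the minimum number of copies of $H$ in an $n$-vertex $F$-saturated graph. $K_m$ is the complete graph on $m$ vertices and $C_m$ is the cycle on $m$ vertices. *)

(* Defs.v *)
From mathcomp Require Import all_boot.

Set Implicit Arguments.
Unset Strict Implicit.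
Unset Printing Implicit Defensive.

(* A graph with vertex set the finite type T is given by its
   set of edges G : {set {set T}}; it is simple when every edge is a pair of
   distinct vertices. *)

Section Graphs.

Definition simple_graph (T : finType) (G : {set {set T}}) : bool :=
  [forall e in G, #|e| == 2].

(* A subgraph is a pair (vertex set, edge set), not necessarily induced. *)
Definition subgraph (T : finType) (G : {set {set T}})
    (S : {set T} * {set {set T}}) : bool :=
  (S.2 \subset G) && [forall e in S.2, e \subset S.1].

Definition isomorphic_to (U T : finType) (H : {set {set U}})
    (S : {set T} * {set {set T}}) : bool :=
  [exists f : {ffun U -> T},
     [&& injectiveb f, f @: [set: U] == S.1 &
         [set f @: e | e : {set U} in H] == S.2]].

Definition copies (U T : finType) (H : {set {set U}}) (G : {set {set T}}) :
    {set {set T} * {set {set T}}} :=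
  [set S | subgraph G S && isomorphic_to H S].

Definition ncopies (U T : finType) (H : {set {set U}}) (G : {set {set T}}) :
  nat := #|copies H G|.

Definition graph_free (U T : finType) (F : {set {set U}}) (G : {set {set T}}) : bool :=
  copies F G == set0.

Definition saturated (U T : finType) (F : {set {set U}}) (G : {set {set T}}) :
    bool :=
  [&& simple_graph G, graph_free F G &
      [forall e : {set T},
         (#|e| == 2) && (e \notin G) ==> (0 < ncopies F (e |: G))]].

(* The minimum of ncopies H G over the F-saturated graphs G with vertex set
   'I_n.  The default set0 of [arg min] is only used if there is no such G,
   which cannot happen when F has an edge (satP, saturated_exists). *)
Definition sat (UH UF : finType) (n : nat) (H : {set {set UH}})
    (F : {set {set UF}}) : nat :=
  ncopies H [arg min_(G < set0 : {set {set 'I_n}} | saturated F G) ncopies H G].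

Definition complete_graph (m : nat) : {set {set 'I_m}} :=
  [set e : {set 'I_m} | #|e| == 2].

(* The cycle on m vertices, for m >= 3 only. *)
Definition cycle_graph (m : nat) : {set {set 'I_m}} :=
  [set [set i; ordS i] | i : 'I_m].

End Graphs.

Lemma satP (UH UF : finType) (n : nat) (H : {set {set UH}}) (F : {set {set UF}}) :
  (exists G : {set {set 'I_n}}, saturated F G) ->
  (exists2 G : {set {set 'I_n}}, saturated F G & ncopies H G = sat n H F) /\
  (forall G : {set {set 'I_n}}, saturated F G -> sat n H F <= ncopies H G).
Proof.
case=> G0 G0P; rewrite /sat.
have -> : [arg min_(G < set0 : {set {set 'I_n}} | saturated F G) ncopies H G] =
          [arg min_(G < G0 | saturated F G) ncopies H G].
  have := arg_minnP (ncopies H) G0P; rewrite /arg_min /extremum.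
  case: pickP => //= no [G GP Gmin]; case/negP: (negbT (no G)).
  by rewrite /= GP; apply/forallP=> G'; apply/implyP/Gmin.
by case: arg_minnP => // G GP Gmin; split=> //; exists G.
Qed.

Lemma saturated_exists (U T : finType) (F : {set {set U}}) :
  F != set0 -> exists G : {set {set T}}, saturated F G.
Proof.
move=> F0; pose P (G : {set {set T}}) := simple_graph G && graph_free F G.
have P0 : P set0.
  apply/andP; split; first by apply/forallP=> e; rewrite inE.
  apply/eqP/setP=> -[W B]; rewrite !inE /subgraph /=; apply/negP.
  case/andP=> /andP[]; rewrite subset0 => /eqP -> _ /existsP[f /and3P[_ _]].
  have [e eF] := set0Pn _ F0.
  by move=> /eqP/setP/(_ (f @: e)); rewrite inE imset_f.
have [G /maxsetP[/andP[sG fG] Gmax] _] := maxset_exists P0.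
exists G; apply/and3P; split=> //; apply/forallP=> e; apply/implyP.
case/andP=> e2 eG; rewrite lt0n cards_eq0; apply: contra eG => fr.
have <- : e |: G = G; last by rewrite setU11.
apply: Gmax; last exact: subsetUr.
rewrite /P /graph_free fr andbT; apply/forall_inP=> d; rewrite in_setU1.
by case/predU1P=> [->//|dG]; exact: (forall_inP sG).
Qed.

Lemma simple_complete_graph (m : nat) : simple_graph (complete_graph m).
Proof. by apply/forall_inP=> e; rewrite inE. Qed.

Lemma simple_cycle_graph (m : nat) : 1 < m -> simple_graph (cycle_graph m).
Proof.
move=> m1; apply/forall_inP=> _ /imsetP[i _ ->]; rewrite cards2 eqSS eqb1.
apply/eqP=> /(congr1 val) /= E; have im := ltn_ord i.
have := im; rewrite leq_eqVlt => /predU1P[ei|lt].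
  by move: E; rewrite ei modnn => i0; move: ei m1; rewrite i0 => <-.
by move: E; rewrite modn_small // => /eqP; rewrite -{1}[val i]addn0 -addn1 eqn_add2l.
Qed.

(* Main.v *)
Require Import Defs.
From mathcomp Require Import all_boot all_order all_algebra.
From mathcomp Require Import zify lra.
From mathcomp Require Import reals exp.

(** Upper bound: join two adjacent vertices to every other vertex, and add no
    other edge.  Any new edge completes a K_4 with the two hubs, and every
    four-cycle consists of the two hubs and an opposite pair of non-hubs, so
    there are 'C(n - 2, 2) of them.

    Lower bound: let G be K_4-saturated.  Adding a nonedge e creates a K_4, and
    this K_4 without e contains a four-cycle of G that has e as a diagonal.
    The other pairs of its four vertices are all edges, so the cycle
    determines e.  Hence G has at least as many four-cycles as nonedges, and
    the number of four-cycles is at least 'C(n, 2) - #|G|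
    (nonedges_le_cycles4).  This settles the case where G is sparse.

    If G is dense, it has many four-cycles by convexity.  A four-cycle is a
    pair of opposite vertices P together with two common neighbours of P, so
    the paths with two edges, counted by their pair of endpoints, bound the
    number of four-cycles from below; and the degrees bound the number of these
    paths from below in terms of #|G|.  With explicit constants, fewer than
    'C(n, 2) four-cycles force 4 #|G|^2 <= 5 n^3 (few_cycles4_sparse).

    So sat is at least 'C(n, 2) - m for some m with 4 m^2 <= 5 n^3.  The factor
    5/4 is absorbed by passing to exponent 5/3: m^6 <= n^10 as soon as n >= 2. *)

(** * Cliques and four-cycles as copies *)

Section Copies.

Local Set Implicit Arguments.
Local Unset Strict Implicit.

Lemma complete_copyP (T : finType) m (G : {set {set T}}) :
  reflect (exists2 W : {set T}, #|W| = m &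
             forall e : {set T}, e \subset W -> #|e| = 2 -> e \in G)
          (0 < ncopies (complete_graph m) G).
Proof.
rewrite lt0n cards_eq0; apply: (iffP (set0Pn _)).
  move=> [[W E]]; rewrite !inE /subgraph /= => /andP[/andP[EG _]].
  move=> /existsP[f /and3P[/injectiveP finj /eqP fW /eqP fE]]; exists W.
    by rewrite -[W]fW card_imset // cardsT card_ord.
  move=> e eW e2; apply: (subsetP EG); rewrite -[E]fE.
  have fK : f @: (f @^-1: e) = e.
    apply/setP=> x; apply/imsetP/idP => [[i + ->]|xe]; first by rewrite inE.
    have := subsetP eW x xe; rewrite -[W]fW => /imsetP[i _ xi].
    by exists i; rewrite // inE -xi.
  by rewrite -fK imset_f // inE -(card_imset _ finj) fK e2.
move=> [W Wm WG]; pose f := [ffun i : 'I_m => enum_val (cast_ord (esym Wm) i)].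
have finj : injective f.
  by move=> i j; rewrite !ffunE => /enum_val_inj /cast_ord_inj.
have fW : f @: [set: 'I_m] = W.
  apply/eqP; rewrite eqEcard card_imset // cardsT card_ord Wm leqnn andbT.
  by apply/subsetP=> _ /imsetP[i _ ->]; rewrite ffunE enum_valP.
have fsub (e : {set 'I_m}) : f @: e \subset W by rewrite -fW imsetS ?subsetT.
exists (W, [set f @: e | e : {set 'I_m} in complete_graph m]).
rewrite inE /subgraph /=; apply/andP; split.
  apply/andP; split.
    apply/subsetP=> d /imsetP[e + ->]; rewrite inE => /eqP e2.
    by apply: WG; rewrite ?card_imset.
  by apply/forall_inP=> _ /imsetP[e _ ->].
by apply/existsP; exists f; rewrite fW !eqxx !andbT; apply/injectiveP.
Qed.

(** The four-cycle is K_{2,2}.  Describing it by its two pairs of opposite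
    vertices, instead of a cyclic ordering, removes most of the symmetry from
    the counting: only P and Q can be exchanged. *)
Definition biclique (T : finType) (P Q : {set T}) : {set T} * {set {set T}} :=
  (P :|: Q, [set [set p; q] | p in P, q in Q]).

Lemma bicliqueC (T : finType) (P Q : {set T}) : biclique P Q = biclique Q P.
Proof.
rewrite /biclique setUC; congr pair.
by apply/setP=> e; apply/imset2P/imset2P => -[p q pP qQ ->];
  exists q p; rewrite // setUC.
Qed.

Lemma biclique_imset (U T : finType) (f : U -> T) (P Q : {set U}) :
  [set f @: e | e : {set U} in (biclique P Q).2]
    = (biclique (f @: P) (f @: Q)).2.
Proof.
apply/setP=> e; apply/imsetP/imset2P.
  move=> [_ /imset2P[p q pP qQ ->] ->].
  by exists (f p) (f q); rewrite ?imset_f // imsetU1 imset_set1.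
move=> [_ _ /imsetP[p pP ->] /imsetP[q qQ ->] ->].
exists [set p; q]; last by rewrite imsetU1 imset_set1.
by apply/imset2P; exists p q.
Qed.

Let evens : {set 'I_4} := [set inord 0; inord 2].
Let odds : {set 'I_4} := [set inord 1; inord 3].

Let evensUodds : evens :|: odds = setT.
Proof.
apply/setP=> -[[|[|[|[|i]]]] //= h]; rewrite !inE -!val_eqE /= !inordK //.
Qed.

Lemma cycle4_biclique : cycle_graph 4 = (biclique evens odds).2.
Proof.
have S (i : nat) : i < 4 -> ordS (inord i : 'I_4) = inord (i.+1 %% 4).
  by move=> i4; apply/val_inj; rewrite /= !inordK // ltn_mod.
have I (i : 'I_4) : i = inord i by rewrite inord_val.
apply/setP=> e; apply/imsetP/imset2P.
  move=> [i _ ->]; rewrite (I i) S //.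
  case: i => -[|[|[|[|i]]]] //= _.
  - by exists (inord 0) (inord 1); rewrite ?inE ?eqxx ?orbT.
  - by exists (inord 2) (inord 1); rewrite ?inE ?eqxx ?orbT // setUC.
  - by exists (inord 2) (inord 3); rewrite ?inE ?eqxx ?orbT.
  - by exists (inord 0) (inord 3); rewrite ?inE ?eqxx ?orbT // setUC.
move=> [_ _ /set2P[] -> /set2P[] -> ->].
- by exists (inord 0); rewrite // S.
- by exists (inord 3); rewrite // S // setUC.
- by exists (inord 1); rewrite // S // setUC.
- by exists (inord 2); rewrite // S.
Qed.

Lemma cycle4_copyP (T : finType) (G : {set {set T}}) S :
  reflect (exists P Q : {set T}, [/\ #|P| = 2, #|Q| = 2, [disjoint P & Q],
             (biclique P Q).2 \subset G & S = biclique P Q])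
          (S \in copies (cycle_graph 4) G).
Proof.
have E2 : #|evens| = 2 by rewrite cards2 -val_eqE /= !inordK.
have O2 : #|odds| = 2 by rewrite cards2 -val_eqE /= !inordK.
have EO : [disjoint evens & odds].
  rewrite -leq_card_setU evensUodds cardsT card_ord E2 O2 //.
rewrite inE /isomorphic_to cycle4_biclique; apply: (iffP idP).
  case: S => W E /andP[/andP[/= EG _]] /existsP[f].
  move=> /and3P[/injectiveP finj /eqP fW /eqP fE].
  have /= Eb := etrans (esym fE) (biclique_imset f evens odds).
  exists (f @: evens), (f @: odds); rewrite !card_imset //; split => //.
  - by rewrite imset_disjoint // => ? ? _ _; apply: finj.
  - by rewrite -Eb.
  - by rewrite [E]Eb -[W]fW -evensUodds imsetU.
move=> [P [Q [P2 Q2 PQ PQG ->]]]; rewrite /subgraph PQG /=.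
apply/andP; split.
  apply/forall_inP=> _ /imset2P[p q pP qQ ->].
  by apply/subsetP=> x /set2P[]->; rewrite inE ?pP ?qQ ?orbT.
have /cards2P[p [p' [pp' Pe]]] := introT eqP P2.
have /cards2P[q [q' [qq' Qe]]] := introT eqP Q2.
pose f := [ffun i : 'I_4 => nth p [:: p; q; p'; q'] i].
have fE : f @: evens = P.
  by rewrite Pe /evens imsetU1 imset_set1 !ffunE !inordK.
have fO : f @: odds = Q.
  by rewrite Qe /odds imsetU1 imset_set1 !ffunE !inordK.
apply/existsP; exists f; rewrite (biclique_imset f evens odds) -evensUodds.
rewrite imsetU fE fO !eqxx !andbT.
have fset : f @: [set: 'I_4] = P :|: Q by rewrite -evensUodds imsetU fE fO.
suff /imset_injP finj : #|f @: [set: 'I_4]| == #|[set: 'I_4]|.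
  by apply/injectiveP=> i j; apply: finj.
by rewrite fset cardsU (disjoint_setI0 PQ) cards0 P2 Q2 cardsT card_ord.
Qed.

End Copies.

(** * Each nonedge of a saturated graph gives its own four-cycle *)

Section Saturated.

Local Set Implicit Arguments.
Local Unset Strict Implicit.

Definition nonedges (T : finType) (G : {set {set T}}) : {set {set T}} :=
  [set e : {set T} | #|e| == 2 & e \notin G].

Lemma card_edges_nonedges (T : finType) (G : {set {set T}}) :
  simple_graph G -> #|G| + #|nonedges G| = 'C(#|T|, 2).
Proof.
move=> /forall_inP sG; rewrite -card_draws -[RHS](cardsID G).
congr addn; apply: eq_card => e; last by rewrite !inE andbC.
by rewrite !inE andb_idl // => /sG.
Qed.

(** The cycle is the K_4 created by e, without e and the opposite diagonal.
    All pairs of vertices of that K_4 other than e are edges of G; this is what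
    makes e recoverable from the cycle. *)
Lemma saturated_nonedge (T : finType) (G : {set {set T}}) (e : {set T}) :
  saturated (complete_graph 4) G -> e \in nonedges G ->
  exists2 S, S \in copies (cycle_graph 4) G &
             e \subset S.1 /\ forall e' : {set T},
               e' \subset S.1 -> e' \in nonedges G -> e' = e.
Proof.
move=> /and3P[sG frG /forallP/(_ e)/implyP sat_e]; rewrite inE => eN.
have /andP[/eqP e2 _] := eN.
have /complete_copyP[W W4 WG] := sat_e eN.
have only_e (d : {set T}) : d \subset W -> d \in nonedges G -> d = e.
  move=> dW; rewrite inE => /andP[/eqP d2 dG]; apply/eqP.
  by have := WG d dW d2; rewrite in_setU1 (negbTE dG) orbF.
(* Otherwise the K_4 would already be present in G. *)
have eW : e \subset W.
  apply: contraT => eW; move: frG; rewrite /graph_free -cards_eq0 -leqn0 leqNgt.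
  case/negP; apply/complete_copyP; exists W => // d dW d2.
  have := WG d dW d2; rewrite in_setU1 => /predU1P[de|//].
  by rewrite -de dW in eW.
have WE : e :|: W :\: e = W.
  apply/setP=> x; rewrite !inE.
  by case: (boolP (x \in e)) => // /(subsetP eW) ->.
exists (biclique e (W :\: e)); last by rewrite /= WE.
apply/cycle4_copyP; exists e, (W :\: e); split=> //.
- by rewrite cardsDS // W4 e2.
- by rewrite -setI_eq0 setIDA setIC -setIDA setDv setI0.
apply/subsetP=> _ /imset2P[p q pe /setDP[qW qe] ->].
have pqW : [set p; q] \subset W.
  by apply/subsetP=> x /set2P[]-> //; apply: (subsetP eW).
have pq2 : #|[set p; q]| = 2.
  by rewrite cards2; case: eqP => // pq; rewrite -pq pe in qe.
have := WG _ pqW pq2; rewrite in_setU1 => /predU1P[E|//].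
by rewrite -E set22 in qe.
Qed.

Lemma nonedges_le_cycles4 (T : finType) (G : {set {set T}}) :
  saturated (complete_graph 4) G ->
  #|nonedges G| <= ncopies (cycle_graph 4) G.
Proof.
move=> satG.
pose diagonal (S : {set T} * {set {set T}}) : {set T} :=
  odflt set0 [pick e in nonedges G | e \subset S.1].
apply: leq_trans (leq_imset_card diagonal _); apply/subset_leq_card.
apply/subsetP=> e eN; have [S SC [eS only_e]] := saturated_nonedge satG eN.
apply/imsetP; exists S => //; rewrite /diagonal.
case: pickP => [e' /andP[e'N e'S]|/(_ e)]; first by rewrite (only_e e').
by rewrite eN eS.
Qed.

End Saturated.

(** * Graphs with few four-cycles are sparse *)

Section Counting.

Local Set Implicit Arguments.
Local Unset Strict Implicit.
Variables (T : finType) (G : {set {set T}}).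
Hypothesis sG : simple_graph G.

Definition neighbours v : {set T} := [set u | [set v; u] \in G].

Definition common_neighbours (P : {set T}) : {set T} :=
  [set v | P \subset neighbours v].

Lemma edge_neq u v : [set u; v] \in G -> u != v.
Proof. by move/(forall_inP sG); rewrite cards2; case: (u != v). Qed.

(** Both sides count the paths with two edges: by their pair of endpoints, and
    by their middle vertex. *)
Lemma sum_common_neighbours :
  \sum_(P : {set T} | #|P| == 2) #|common_neighbours P|
    = \sum_v 'C(#|neighbours v|, 2).
Proof.
rewrite [LHS](eq_bigr (fun P : {set T} =>
  \sum_(v | P \subset neighbours v) 1)); last first.
  by move=> P _; rewrite sum1dep_card.
rewrite (exchange_big_dep predT) //=; apply: eq_bigr => v _.
rewrite -cards_draws -sum1dep_card; apply: eq_bigl => P.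
by rewrite andbC.
Qed.

(** Two common neighbours of P span a four-cycle in which P is a pair of
    opposite vertices; as P is fixed, the cycle determines them. *)
Lemma draws_common_neighbours (P : {set T}) : #|P| = 2 ->
  'C(#|common_neighbours P|, 2)
    <= #|[set S in copies (cycle_graph 4) G | P \subset S.1]|.
Proof.
move=> P2; rewrite -cards_draws.
have dPQ (Q : {set T}) : Q \subset common_neighbours P -> [disjoint P & Q].
  move=> QP; rewrite -setI_eq0; apply/eqP/setP=> x; rewrite !inE.
  apply/negP=> /andP[xP /(subsetP QP)]; rewrite inE => /subsetP/(_ x xP).
  by rewrite inE => /edge_neq; rewrite eqxx.
have inj : {in [set Q : {set T} | Q \subset common_neighbours P & #|Q| == 2] &,
              injective (biclique P)}.
  move=> Q Q'; rewrite !inE => /andP[QP _] /andP[Q'P _] [+ _].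
  have DU (R : {set T}) : R \subset common_neighbours P -> (P :|: R) :\: P = R.
    move=> /dPQ dPR; rewrite setDUl setDv set0U; apply/setDidPl.
    by rewrite disjoint_sym.
  by move=> PQQ'; rewrite -(DU Q) // PQQ' DU.
rewrite -(card_in_imset inj); apply/subset_leq_card/subsetP=> S.
case/imsetP=> Q; rewrite inE => /andP[QP /eqP Q2] ->.
rewrite inE subsetUl andbT.
apply/cycle4_copyP; exists P, Q; split=> //; first exact: dPQ.
apply/subsetP=> _ /imset2P[p q pP /(subsetP QP) + ->].
by rewrite inE => /subsetP/(_ p pP); rewrite inE setUC.
Qed.

(** The factor 6 bounds the number of pairs P inside the vertex set of a
    four-cycle.  Only the two pairs of opposite vertices occur in the count, but
    the cruder bound costs just a constant. *)
Lemma sum_draws_common_neighbours :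
  \sum_(P : {set T} | #|P| == 2) 'C(#|common_neighbours P|, 2)
    <= 6 * ncopies (cycle_graph 4) G.
Proof.
apply: (@leq_trans (\sum_(P : {set T} | #|P| == 2)
    #|[set S in copies (cycle_graph 4) G | P \subset S.1]|)).
  by apply: leq_sum => P /eqP; apply: draws_common_neighbours.
under eq_bigr do rewrite -sum1dep_card.
rewrite (exchange_big_dep (mem (copies (cycle_graph 4) G))) /=; last first.
  by move=> P S _ /andP[].
rewrite mulnC -sum_nat_const leq_sum // => S SC.
rewrite sum1dep_card -[6]/('C(4, 2)).
have /cycle4_copyP[P [Q [P2 Q2 dPQ _ ->]]] := SC.
have W4 : #|P :|: Q| = 4 by rewrite cardsU (disjoint_setI0 dPQ) cards0 P2 Q2.
rewrite -W4 -cards_draws; apply/subset_leq_card/subsetP=> R.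
by rewrite !inE => /andP[-> /andP[_ ->]].
Qed.

Lemma double_edges_le_degrees : 2 * #|G| <= \sum_v #|neighbours v|.
Proof.
have -> : 2 * #|G| = \sum_(e in G) \sum_(v in e) 1.
  rewrite mulnC -sum_nat_const; apply: eq_bigr => e eG.
  by rewrite sum1_card (eqP (forall_inP sG e eG)).
rewrite (exchange_big_dep predT) //=; apply: leq_sum => v _.
rewrite sum1dep_card; apply: leq_trans (leq_imset_card (fun u => [set v; u]) _).
apply/subset_leq_card/subsetP=> e; rewrite inE => /andP[eG ve].
have /cards2P[x [y [_ E]]] := forall_inP sG e eG.
move: ve eG; rewrite E => /set2P[]-> eG; apply/imsetP.
  by exists y; rewrite // inE.
by exists x; rewrite 1?setUC // inE setUC.
Qed.

Lemma sqr_sum_le (I : finType) (F : I -> nat) :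
  (\sum_i F i) ^ 2 <= #|I| * \sum_i F i ^ 2.
Proof.
rewrite -(leq_pmul2l (isT : 0 < 2)) expnS expn1 big_distrlr /= big_distrr /=.
apply: (@leq_trans (\sum_i \sum_j (F i ^ 2 + F j ^ 2))).
  apply: leq_sum => i _; rewrite big_distrr leq_sum // => j _.
  exact: nat_Cauchy.
under eq_bigr do rewrite big_split /= sum_nat_const.
by rewrite big_split /= sum_nat_const -big_distrr /= addnn -mul2n.
Qed.

(** Convexity is used twice.  For the codegrees it takes the form of the
    linear bound 3 d <= 'C(d, 2) + 6, so that the sums over all pairs can
    be compared directly; for the degrees it is the Cauchy-Schwarz
    inequality. *)
Lemma few_cycles4_sparse :
  ncopies (cycle_graph 4) G < 'C(#|T|, 2) -> 4 * #|G| ^ 2 <= 5 * #|T| ^ 3.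
Proof.
move=> few; pose D := \sum_v #|neighbours v|.
have bin2E n : n ^ 2 = 2 * 'C(n, 2) + n.
  by elim: n => // n IH; rewrite binS bin1 -addn1 sqrnD; lia.
(* This is (d - 3) (d - 4) >= 0; the slope 3 balances the factor 6 above. *)
have tangent d : 3 * d <= 'C(d, 2) + 6.
  have := bin2E d; rewrite expnS expn1; have [] := leqP d 3; nia.
have walks : \sum_v 'C(#|neighbours v|, 2) <= 4 * 'C(#|T|, 2).
  have := sum_draws_common_neighbours.
  rewrite -sum_common_neighbours.
  have : 3 * \sum_(P : {set T} | #|P| == 2) #|common_neighbours P|
      <= \sum_(P : {set T} | #|P| == 2) ('C(#|common_neighbours P|, 2) + 6).
    by rewrite big_distrr leq_sum // => P _; apply: tangent.
  rewrite big_split /= sum_nat_const.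
  have -> : #|[pred P : {set T} | #|P| == 2]| = 'C(#|T|, 2).
    by rewrite -card_draws; apply: eq_card => P; rewrite !inE.
  have lin x y c N : 3 * x <= y + N * 6 -> y <= 6 * c -> c < N -> x <= 4 * N.
    by lia.
  by move=> lower upper; apply: lin lower upper few.
have squares : \sum_v #|neighbours v| ^ 2
    = 2 * \sum_v 'C(#|neighbours v|, 2) + D.
  by under eq_bigr do rewrite bin2E; rewrite big_split /= -big_distrr.
have Dn : D <= #|T| ^ 2.
  rewrite expnS expn1 -sum_nat_const leq_sum // => v _; exact: max_card.
have CS := sqr_sum_le (fun v => #|neighbours v|).
have := double_edges_le_degrees; rewrite -/D in CS squares *.
have := bin2E #|T|; move: CS; rewrite squares => CS.
set n := #|T| in few walks Dn CS *; set m := #|G|; move=> bn mD.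
have S5 : 2 * \sum_v 'C(#|neighbours v|, 2) + D <= 5 * n ^ 2 by lia.
have : (2 * m) ^ 2 <= D ^ 2 by rewrite leq_sqr.
have : n * (2 * \sum_v 'C(#|neighbours v|, 2) + D) <= n * (5 * n ^ 2).
  by rewrite leq_mul2l S5 orbT.
rewrite expnMn (_ : n * (5 * n ^ 2) = 5 * n ^ 3);
  last by rewrite (expnS n 2); lia.
lia.
Qed.

End Counting.

(** * The extremal construction: two dominating vertices *)

Section TwoHubs.

Local Set Implicit Arguments.
Local Unset Strict Implicit.
Variables (T : finType) (A : {set T}).
Hypothesis A2 : #|A| = 2.

(** Two adjacent hubs, the vertices of A, joined to all other vertices. *)
Definition pairs_meeting : {set {set T}} :=
  [set e : {set T} | #|e| == 2 & ~~ [disjoint e & A]].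

Lemma pairs_meeting_saturated : saturated (complete_graph 4) pairs_meeting.
Proof.
apply/and3P; split.
- by apply/forall_inP=> e; rewrite inE => /andP[].
- rewrite /graph_free -cards_eq0 -leqn0 leqNgt.
  apply/negP=> /complete_copyP[W W4 WG].
  (* Two vertices of a K_4 are not hubs, and they are not adjacent. *)
  have : 1 < #|W :\: A|.
    have := subset_leq_card (subsetIr W A).
    by rewrite cardsD W4 A2; lia.
  case/card_gt1P=> x [y [/setDP[xW xA] /setDP[yW yA] xy]].
  have : [set x; y] \in pairs_meeting.
    apply: WG; first by apply/subsetP=> z /set2P[]->.
    by rewrite cards2 xy.
  rewrite inE => /andP[_ /negP[]]; rewrite -setI_eq0; apply/eqP/setP=> z.
  by rewrite !inE; case: eqP => [->|_]; [exact/negbTE | case: eqP => // ->;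
    exact/negbTE].
apply/forallP=> e; apply/implyP=> /andP[/eqP e2].
rewrite inE e2 eqxx /= negbK => eA.
apply/complete_copyP; exists (e :|: A).
  by rewrite cardsU (disjoint_setI0 eA) cards0 e2 A2.
move=> d dW d2; rewrite !inE d2 eqxx /=.
have [dA|] := boolP [disjoint d & A]; last by rewrite orbT.
rewrite orbF eqEcard e2 d2 leqnn andbT; apply/subsetP=> x xd.
have := subsetP dW x xd; rewrite inE => /orP[//|].
by rewrite (disjointFr dA xd).
Qed.

(** A vertex of P that is not a hub is adjacent only to hubs, so Q consists of
    hubs. *)
Lemma biclique_pairs_meeting (P Q : {set T}) :
  #|P| = 2 -> #|Q| = 2 -> (biclique P Q).2 \subset pairs_meeting ->
  P = A \/ Q = A.
Proof.
move=> P2 Q2 PQG; have [PA|/subsetPn[p pP pA]] := boolP (P \subset A).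
  by left; apply/eqP; rewrite eqEcard PA P2 A2.
right; apply/eqP; rewrite eqEcard Q2 A2 andbT; apply/subsetP=> q qQ.
have : [set p; q] \in pairs_meeting.
  by apply: (subsetP PQG); apply/imset2P; exists p q.
rewrite inE -setI_eq0 => /andP[_ /set0Pn[x /setIP[/set2P[]-> //]]].
by rewrite (negbTE pA).
Qed.

Lemma ncopies_pairs_meeting :
  ncopies (cycle_graph 4) pairs_meeting <= 'C(#|T| - 2, 2).
Proof.
have <- : #|~: A| = #|T| - 2 by rewrite cardsCs setCK A2.
rewrite -cards_draws; apply: leq_trans (leq_imset_card (biclique A) _).
apply/subset_leq_card/subsetP=> S /cycle4_copyP[P [Q [P2 Q2 dPQ PQG ->]]].
wlog PA : P Q P2 Q2 dPQ PQG / P = A.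
  move=> wl; have [PA|QA] := biclique_pairs_meeting P2 Q2 PQG; first exact: wl.
  by rewrite bicliqueC in PQG *; apply: wl => //; rewrite disjoint_sym.
rewrite PA; apply: imset_f; rewrite inE Q2 eqxx andbT -disjoints_subset.
by rewrite disjoint_sym -PA.
Qed.

End TwoHubs.

(** * The bounds on the saturation number *)

Lemma complete_graph4_neq0 : complete_graph 4 != set0.
Proof. by apply/set0Pn; exists [set ord0; ord_max]; rewrite inE cards2. Qed.

Lemma sat_cycle4_le n : 2 <= n ->
  sat n (cycle_graph 4) (complete_graph 4) <= 'C(n - 2, 2).
Proof.
move=> n2; have [A A2] : exists A : {set 'I_n}, #|A| = 2.
  have : 0 < #|[set A : {set 'I_n} | #|A| == 2]|.
    by rewrite card_draws card_ord bin_gt0.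
  by case/card_gt0P=> A; rewrite inE => /eqP; exists A.
have [_ minG] :=
  satP (cycle_graph 4) (saturated_exists 'I_n complete_graph4_neq0).
apply: leq_trans (minG _ (pairs_meeting_saturated A2)) _.
by have := ncopies_pairs_meeting A2; rewrite card_ord.
Qed.

(** Here m is the number of edges of an extremal graph G if G has few
    four-cycles, and 0 if G has at least 'C(n, 2) of them. *)
Lemma sat_cycle4_ge n : 2 <= n ->
  exists2 m, 'C(n, 2) <= sat n (cycle_graph 4) (complete_graph 4) + m
           & m ^ 6 <= n ^ 10.
Proof.
move=> n2.
have [[G satG <-] _] :=
  satP (cycle_graph 4) (saturated_exists 'I_n complete_graph4_neq0).
have [sG _ _] := and3P satG.
have [many|few] := leqP 'C(n, 2) (ncopies (cycle_graph 4) G).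
  by exists 0; rewrite ?addn0 ?exp0n.
exists #|G|.
  have := card_edges_nonedges sG; rewrite card_ord => <-.
  by rewrite addnC leq_add2r nonedges_le_cycles4.
have := few_cycles4_sparse sG; rewrite card_ord => /(_ few) m2.
have : (4 * #|G| ^ 2) ^ 3 <= (5 * n ^ 3) ^ 3 by rewrite leq_exp2r.
rewrite (expnMn 4) (expnMn 5) -!expnM => m6; rewrite (expnS n 9).
have : 2 * n ^ 9 <= n * n ^ 9 by rewrite leq_mul2r n2 orbT.
by lia.
Qed.

Import Order.TTheory GRing.Theory Num.Theory.
Local Open Scope ring_scope.

Theorem proposition1p6 (R : realType) (delta : R) (hdelta : 0 < delta) :
  exists n0 : nat, forall n : nat, (n0 <= n)%N ->
    ('C(n, 2)%:R - n%:R `^ (5 / 3 + delta)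
       <= (sat n (cycle_graph 4) (complete_graph 4))%:R :> R) /\
    (sat n (cycle_graph 4) (complete_graph 4) <= 'C(n - 2, 2))%N.
Proof.
exists 2 => n n2; split; last exact: sat_cycle4_le.
have [m le_sat m6] := sat_cycle4_ge n n2.
have n1 : (1 : R) <= n%:R by rewrite ler1n ltnW.
rewrite lerBlDr.
apply: (@le_trans _ _ (sat n (cycle_graph 4) (complete_graph 4) + m)%:R).
  by rewrite ler_nat.
rewrite natrD lerD2l.
apply: (@le_trans _ _ (n%:R `^ (5 / 3))); last first.
  by rewrite ler_powR // lerDl ltW.
rewrite -(@ler_pXn2r _ 6) ?nnegrE ?powR_ge0 ?ler0n //.
rewrite -(powR_mulrn 6 (powR_ge0 _ _)) -powRrM.
have -> : (5 / 3 * 6%:R : R) = 10%:R by lra.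
by rewrite powR_mulrn ?ler0n // -!natrX ler_nat.
Qed.
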